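(* Let $m\in\mathbb{Z}_+$ and let $B_0,\ldots,B_m$ be closed linear operators from $H$ to $H'$ with domains $\mathcal{D}(B_j)\subset H$ such that: $e_n\in\bigcap_{j=0}^m\mathcal{D}(B_j)$ for every $n\in M$; $(B_je_{n'},B_je_{n''})_{H'}=0$ for all $j\in\{0,\ldots,m\}$ and all $n',n''\in M$ with $n'\neq n''$; and there exist $j_0\in\{0,\ldots,m\}$ and $n_0\in M$ with $B_{j_0}e_{n_0}\neq0$. Let $X$ be a normed space over $\mathbb{C}$, $A:H\to X$ a linear operator with domain $\mathcal{D}(A)\subset H$, and $f\in X^*$ a bounded linear functional such that: $e_n\in\mathcal{D}(A)$ for every $n\in M$; there exists $n_0\in M$ with $\langle f,Ae_{n_0}\rangle\neq0$; and the functional $g_f(x)=\langle f,Ax\rangle$ from $H$ to $\mathbb{C}$ with domain $\mathcal{D}(A)$ is closable. Let $\lambda_0,\ldots,\lambda_m>0$ be such that $\lambda_0+\ldots+\lambda_m=1$ and $$\mathcal{C}:=\sup_{\mathbf{h}\in\mathbb{R}_+^{m+1}}\ \prod_{j=0}^m h_j^{\lambda_j}\ \widetilde{\sum_{n\in M}}\frac{|\langle f,Ae_n\rangle|^2}{b_{n,\mathbf{h}}}<\infty .$$ Then for every $x\in\mathcal{D}(A)\cap H_{\mathbf{B}}$, $$|\langle f,Ax\rangle|\leqslant\sqrt{\mathcal{C}\cdot\prod_{j=0}^m\lambda_j^{-\lambda_j}}\cdot\prod_{j=0}^m\|B_jx\|_{H'}^{\lambda_j},$$ and this inequality is sharp (the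 constant cannot be replaced by a smaller one).
   Context: $\mathbb{R}_+=(0,+\infty)$; $\mathbb{Z}_+$ is the set of non-negative integers. $H$ is a separable Hilbert space over $\mathbb{C}$ with orthonormal basis $\{e_n\}_{n\in M}$, $M$ finite or countable; $x_n:=(x,e_n)_H$. Sums over $M$ are limits of sums over a fixed sequence of nested finite sets $M_1\subset M_2\subset\ldots$ with union $M$. $H'$ is a Hilbert space over $\mathbb{C}$. For non-negative sequences $\{a_n\},\{b_n\}$, the sum $\widetilde{\sum}_{n\in M}\frac{a_n}{b_n}$ equals $+\infty$ if there is $n_0$ with $a_{n_0}\neq0$ and $b_{n_0}=0$, and otherwise equals $\sum_{n\in M:\,b_n\neq0}\frac{a_n}{b_n}$ (an empty sum is $0$). For $\mathbf{h}=(h_0,\ldots,h_m)\in\mathbb{R}_+^{m+1}$: $b_{n,\mathbf{h}}:=\sum_{j=0}^m h_j\|B_je_n\|_{H'}^2$. Further, $H_{\mathbf{B}}:=\{x\in H:\ \sum_{n\in M}|x_n|^2\|B_je_n\|_{H'}^2<\infty,\ j=0,\ldots,m\}$; under the stated hypotheses on the $B_j$ one has $H_{\mathbf{B}}\subset\bigcap_{j=0}^m\mathcal{D}(B_j)$. An operator is closable if the closure of its graph is the graph of an operator. *)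

(* Defs.v *)
From HB Require Import structures.
From mathcomp Require Import all_boot all_order all_algebra.
From mathcomp Require Import finmap.
From mathcomp Require Import all_classical all_reals all_analysis.
From mathcomp Require Import complex.
Import Order.TTheory GRing.Theory Num.Theory.
Import numFieldNormedType.Exports.
Set Implicit Arguments.
Unset Strict Implicit.
Unset Printing Implicit Defensive.
Local Open Scope classical_set_scope.
Local Open Scope ring_scope.

(* For a space over R[i] the library norm is R[i]-valued (a nonnegative real
   element of R[i]); nrm is the same number as an element of R. *)
Definition nrm (R : realType) (V : normedZmodType R[i]) (x : V) : R :=
  complex.Re `|x|.

(* A positive definite sesquilinear form, linear in its first argument, that
   induces the norm: together with completeness of H this makes H a Hilbert
   space. *)
Definition induces_norm (R : realType) (H : normedModType R[i])
    (dot : {dot H for @Num.conj R[i]}) : Prop :=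
  forall x : H, dot x x = `|x| ^+ 2.

(* A linear operator from U to V with a linear domain dom `<=` U; the values of
   app outside dom are irrelevant. *)
Record linop (K : numFieldType) (U V : normedModType K) := LinOp {
  dom : set U ;
  app :> U -> V ;
  dom_zero : dom 0 ;
  dom_lin : forall (a : K) (x y : U), dom x -> dom y -> dom (a *: x + y) ;
  app_lin : forall (a : K) (x y : U), dom x -> dom y ->
    app (a *: x + y) = a *: app x + app y }.

Definition graph (K : numFieldType) (U V : normedModType K) (T : linop U V) :
    set (U * V) :=
  [set p | dom T p.1 /\ p.2 = T p.1].

Definition closed_op (K : numFieldType) (U V : normedModType K)
    (T : linop U V) : Prop :=
  closed (graph T).

Definition closable (K : numFieldType) (U V : normedModType K)
    (T : linop U V) : Prop :=
  exists S : linop U V, closure (graph T) = graph S.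

Section LinopComp.
Variables (K : numFieldType) (U V W : normedModType K).
Variables (f : {linear V -> W}) (T : linop U V).

Let comp_lin (a : K) (x y : U) : dom T x -> dom T y ->
  f (T (a *: x + y)) = a *: f (T x) + f (T y).
Proof. by move=> Tx Ty; rewrite app_lin// linearP. Qed.

Definition linop_comp : linop U W :=
  LinOp (dom_zero T) (@dom_lin _ _ _ T) comp_lin.
End LinopComp.

(* Every sum over the countable index set M is the limit of its partial sums over
   a fixed nested sequence Mk of finite sets with union M. *)
Definition exhaustion (M : choiceType) (Mk : nat -> {fset M}) : Prop :=
  (forall k, (Mk k `<=` Mk k.+1)%fset) /\ (forall n, exists k, n \in Mk k).

Definition lin_span (K : numFieldType) (U : normedModType K) (M : Type)
    (e : M -> U) : set U :=
  [set x | exists (s : seq M) (c : M -> K), x = \sum_(n <- s) c n *: e n].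

Definition orthonormal_basis (R : realType) (H : normedModType R[i])
    (dot : {dot H for @Num.conj R[i]}) (M : eqType) (e : M -> H) : Prop :=
  (forall n n', dot (e n) (e n') = (n == n')%:R) /\ dense (lin_span e).

Definition sumM (R : realType) (M : choiceType) (Mk : nat -> {fset M})
    (a : M -> R) : \bar R :=
  limn (fun k => \sum_(n <- Mk k) (a n)%:E)%E.

(* The sum of a_n / b_n for nonnegative a, b, with 0 / 0 = 0 and a_n / 0 = +oo
   when a_n is nonzero. *)
Definition tilde_sum (R : realType) (M : choiceType) (Mk : nat -> {fset M})
    (a b : M -> R) : \bar R :=
  if `[< exists n, a n <> 0 /\ b n = 0 >] then +oo%E
  else limn (fun k => \sum_(n <- Mk k | (b n != 0)%R) (a n / b n)%:E)%E.

Definition bh (R : realType) (H H' : normedModType R[i]) (M : Type)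
    (e : M -> H) (m : nat) (B : 'I_m.+1 -> linop H H')
    (h : 'I_m.+1 -> R) (n : M) : R :=
  \sum_(j < m.+1) h j * nrm (B j (e n)) ^+ 2.

Definition HB_space (R : realType) (H H' : normedModType R[i])
    (dot : {dot H for @Num.conj R[i]}) (M : choiceType)
    (Mk : nat -> {fset M}) (e : M -> H) (m : nat)
    (B : 'I_m.+1 -> linop H H') : set H :=
  [set x | forall j,
    (sumM Mk (fun n => (nrm (dot x (e n) : R[i]^o)) ^+ 2
                       * nrm (B j (e n)) ^+ 2)%R < +oo)%E].

Definition supC (R : realType) (H H' X : normedModType R[i])
    (M : choiceType) (Mk : nat -> {fset M}) (e : M -> H) (m : nat)
    (B : 'I_m.+1 -> linop H H') (A : linop H X) (f : {linear X -> R[i]^o})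
    (lam : 'I_m.+1 -> R) : \bar R :=
  ereal_sup [set ((\prod_(j < m.+1) h j `^ lam j)%R%:E
                  * tilde_sum Mk (fun n => nrm (f (A (e n))) ^+ 2)%R
                                 (bh e B h))%E
            | h in [set h : 'I_m.+1 -> R | forall j, 0 < h j]].

(* Main.v *)
(* A closable functional is bounded, so f(Ax) is the limit of f(A S_k x), where
   S_k x are the partial Fourier sums; since the B_j are closed and the B_j e_n
   orthogonal, also B_j S_k x -> B_j x. Weighted Cauchy-Schwarz on M_k gives
   prod_j h_j^lam_j |f(A S_k x)|^2 <= C sum_j h_j |B_j S_k x|^2 for all h > 0;
   let k tend to infinity and optimise over h. Conversely, for fixed h and k, the
   equality case x = sum_{n in M_k} conj(f(A e_n)) / b_{n,h} e_n of
   Cauchy-Schwarz together with the weighted arithmetic-geometric mean inequality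
   forces any admissible constant c' to satisfy
   prod_j h_j^lam_j sum_{n in M_k} |f(A e_n)|^2 / b_{n,h}
     <= c'^2 prod_j lam_j^lam_j. *)
Require Import Defs.
From mathcomp Require Import all_boot all_order all_algebra.
From mathcomp Require Import finmap.
From mathcomp Require Import all_classical all_reals all_analysis.
From mathcomp Require Import complex.
From mathcomp Require Import ring lra.
Import Order.TTheory GRing.Theory Num.Theory.
Import numFieldNormedType.Exports.
Set Implicit Arguments.
Unset Strict Implicit.
Unset Printing Implicit Defensive.
Local Open Scope classical_set_scope.
Local Open Scope ring_scope.

(** * Finite inequalities: Cauchy-Schwarz and the weighted geometric mean *)

(** Cauchy-Schwarz for [sqrt (p i)] and [sqrt (q i)], phrased without roots or quotients so that
    vanishing weights need no special form. *)
Lemma sqr_sum_le_mul_sum (R : realType) (I : Type) (s : seq I) (P : pred I)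
    (a p q : I -> R) :
  (forall i, P i -> 0 <= a i) -> (forall i, P i -> 0 <= p i) ->
  (forall i, P i -> 0 <= q i) -> (forall i, P i -> a i ^+ 2 <= p i * q i) ->
  (\sum_(i <- s | P i) a i) ^+ 2
    <= (\sum_(i <- s | P i) p i) * (\sum_(i <- s | P i) q i).
Proof.
move=> a0 p0 q0 apq; elim: s => [|i s IH]; first by rewrite !big_nil expr2 !mulr0.
rewrite !big_cons; case: ifP => // Pi.
have := sumr_ge0 s a0; have := sumr_ge0 s p0; have := sumr_ge0 s q0.
move: (\sum_(j <- s | P j) a j) (\sum_(j <- s | P j) p j)
  (\sum_(j <- s | P j) q j) IH => A p' q' IH q'0 p'0 A0.
have := a0 _ Pi; have := p0 _ Pi; have := q0 _ Pi; have := apq _ Pi.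
move: (a i) (p i) (q i) => x y z xyz z0 y0 x0.
(* The cross term: its square is at most 4 (y q') (z p'), hence at most (y q' + z p')^2. *)
have h : 2 * (x * A) <= y * q' + z * p'.
  rewrite -(@ler_pXn2r _ 2) ?nnegrE//; last 2 first.
  - by rewrite !mulr_ge0.
  - by rewrite addr_ge0// mulr_ge0.
  have : x ^+ 2 * A ^+ 2 <= y * z * (p' * q') by rewrite ler_pM// sqr_ge0.
  have := sqr_ge0 (y * q' - z * p').
  nra.
nra.
Qed.

Section weighted_geometric_mean.
Context {R : realType} (m : nat) (lam : 'I_m.+1 -> R).
Hypotheses (lam_gt0 : forall j, 0 < lam j) (sum_lam : \sum_j lam j = 1).

(** Dividing by the mean [S] reduces the claim to a product of powers of [t j / S] being at most 1.
    This follows from u <= exp (u - 1), since the exponents [(t j / S - 1) * lam j] sum to 0. *)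
Lemma weighted_AGM (t : 'I_m.+1 -> R) : (forall j, 0 <= t j) ->
  \prod_j t j `^ lam j <= \sum_j lam j * t j.
Proof.
move=> t0; set S := \sum_j _.
have S0 : 0 <= S by apply: sumr_ge0 => j _; rewrite mulr_ge0// ltW.
have [S_gt0|] := ltP 0 S; last first.
  (* If the mean is 0, all [t j] vanish; the factor at [ord0] already makes the product 0, because
     [lam ord0 > 0]. *)
  move=> Sle0; have /eqP : S = 0 by apply/eqP; rewrite eq_le Sle0.
  rewrite psumr_eq0 => [|j _]; last by rewrite mulr_ge0// ltW.
  move=> /allP /(_ ord0 (mem_index_enum _)) /=.
  rewrite mulf_eq0 gt_eqF//= => /eqP t00.
  by rewrite (bigD1 ord0)//= t00 powR0 ?gt_eqF// mul0r.
have tE j : t j `^ lam j = S `^ lam j * (t j / S) `^ lam j.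
  by rewrite -powRM ?divr_ge0// mulrCA divff ?mulr1 ?gt_eqF.
under eq_bigr do rewrite tE.
have prodS : \prod_j S `^ lam j = S.
  transitivity (S `^ (\sum_j lam j)); last by rewrite sum_lam powRr1.
  elim/big_rec2 : _ => [|j y x _ ->]; first by rewrite powRr0.
  by rewrite powRD// (gt_eqF S_gt0) implybT.
rewrite big_split/= prodS -[leRHS]mulr1 ler_pM2l//.
rewrite [leRHS](_ : 1 = \prod_j expR ((t j / S - 1) * lam j)); last first.
  rewrite -expR_sum; under eq_bigr do rewrite mulrBl mul1r mulrAC.
  rewrite sumrB sum_lam -mulr_suml.
  under eq_bigr do rewrite mulrC.
  by rewrite -/S divff ?gt_eqF// subrr expR0.
apply: ler_prod => j _; rewrite powR_ge0 expRM ge0_ler_powR ?nnegrE ?expR_ge0//.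
- exact: ltW.
- exact: divr_ge0.
- by have := expR_ge1Dx (t j / S - 1); rewrite addrC subrK.
Qed.

(** The weighted mean inequality at [h j * b j / lam j], with the powers of [lam j] moved to the
    right. *)
Lemma prod_powR_le_sum (h b : 'I_m.+1 -> R) :
  (forall j, 0 < h j) -> (forall j, 0 <= b j) ->
  \prod_j h j `^ lam j * \prod_j b j `^ lam j
    <= \prod_j lam j `^ lam j * \sum_j h j * b j.
Proof.
move=> h0 b0.
have hb j : 0 <= h j * b j by rewrite mulr_ge0// ltW.
have := @weighted_AGM _ (fun j => divr_ge0 (hb j) (ltW (lam_gt0 j))).
under [in X in _ <= X]eq_bigr do rewrite mulrC mulfVK ?gt_eqF//.
rewrite -(@ler_pM2l _ (\prod_j lam j `^ lam j)); last first.
  by apply: prodr_gt0 => j _; rewrite powR_gt0.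
apply: le_trans; rewrite -!big_split/=.
rewrite le_eqVlt; apply/predU1P; left; apply: eq_bigr => j _.
rewrite -!powRM ?divr_ge0//; do ?exact/ltW.
by rewrite mulrCA divff ?mulr1 ?gt_eqF.
Qed.

(* Optimising over [h] gives [h j = lam j / b j]; since [b j] may vanish, take
   [h j = lam j / (b j + r)] and let [r] tend to 0. *)
Lemma le_prod_powR (b : 'I_m.+1 -> R) (G D : R) :
  (forall j, 0 <= b j) -> 0 <= D ->
  (forall h : 'I_m.+1 -> R, (forall j, 0 < h j) ->
     \prod_j h j `^ lam j * G <= D * \sum_j h j * b j) ->
  G <= D * \prod_j lam j `^ (- lam j) * \prod_j b j `^ lam j.
Proof.
move=> b0 D0 hG; set K := D * _.
have bound r : 0 < r -> G <= K * \prod_j (b j + r) `^ lam j.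
  move=> r0; have br j : 0 < b j + r by rewrite ltr_wpDl.
  have lbr j : 0 < lam j / (b j + r) by rewrite divr_gt0.
  have P0 : 0 < \prod_j (lam j / (b j + r)) `^ lam j.
    by apply: prodr_gt0 => j _; rewrite powR_gt0.
  rewrite -(ler_pM2l P0); apply: le_trans (hG _ lbr) _.
  rewrite mulrCA -mulrA -!big_split/= [X in _ <= _ * X]big1 ?mulr1; last first.
    move=> j _; rewrite powRN -powRM ?(ltW (br j)) ?(ltW (lbr j))//.
    by rewrite divfK ?gt_eqF// mulVf// gt_eqF// powR_gt0.
  (* All powers have cancelled; what remains is the sum of lam_j b_j / (b_j + r), bounded termwise
     by the sum of the lam_j, which is 1. *)
  rewrite -[leRHS]mulr1 ler_wpM2l// -sum_lam ler_sum// => j _.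
  by rewrite -mulrA ler_piMr ?(ltW (lam_gt0 _))// mulrC ler_pdivrMr// mul1r lerDl ltW.
have cv : K * \prod_j (b j + r) `^ lam j @[r --> 0^'+]
    --> K * \prod_j b j `^ lam j.
  apply: cvgMr; apply: cvg_big => [|j _]; first exact: mul_continuous.
  (* Continuity of the power comes from differentiability, available only at positive base; base 0
     is a separate one-sided limit. *)
  have := b0 j; rewrite le_eqVlt => /predU1P[<-|bj].
    under eq_fun do rewrite add0r.
    by rewrite powR0 ?gt_eqF//; exact: powR_cvg0.
  have cbr : b j + r @[r --> 0^'+] --> b j.
    rewrite -[X in _ --> X]addr0; apply: cvgD; first exact: cvg_cst.
    exact: cvg_at_right_filter cvg_id.
  apply: (@continuous_cvg _ _ _ _ _ _ (fun x => powR x (lam j)) _ _ cbr).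
  apply/differentiable_continuous/derivable1_diffP/derivable_powR.
  by rewrite in_itv/= bj.
apply: (cvgr_to_ge cv); near=> r; apply: bound; near: r; exact: nbhs_right_gt.
Unshelve. all: by end_near.
Qed.

End weighted_geometric_mean.

(** * Real-valued norms and convergence *)

Section real_valued_norm.
Context {R : realType}.

Lemma nrmE (V : normedZmodType R[i]) (x : V) : `|x| = (nrm x)%:C%C.
Proof. by rewrite /nrm RRe_real// normr_real. Qed.

Lemma nrm_ge0 (V : normedZmodType R[i]) (x : V) : 0 <= nrm x.
Proof. by rewrite -ler0c -nrmE. Qed.

Lemma nrm_eq0 (V : normedZmodType R[i]) (x : V) : (nrm x == 0) = (x == 0).
Proof. by rewrite -(inj_eq (@complexI R)) -nrmE normr_eq0. Qed.

Lemma nrm0 (V : normedZmodType R[i]) : nrm (0 : V) = 0.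
Proof. by apply/eqP; rewrite nrm_eq0. Qed.

Lemma nrmD (V : normedZmodType R[i]) (x y : V) : nrm (x + y) <= nrm x + nrm y.
Proof. by rewrite -lecR rmorphD/= -!nrmE ler_normD. Qed.

Lemma nrmC (V : normedZmodType R[i]) (x y : V) : nrm (x - y) = nrm (y - x).
Proof. by rewrite /nrm distrC. Qed.

Lemma ler_nrm_dist (V : normedZmodType R[i]) (x y : V) :
  `|nrm x - nrm y| <= nrm (x - y).
Proof.
have h (u v : V) : nrm u - nrm v <= nrm (u - v).
  by rewrite lerBlDr -{1}(subrK v u) nrmD.
by rewrite ler_norml h lerNl opprB nrmC h.
Qed.

Lemma nrmZ (V : normedModType R[i]) (a : R[i]) (x : V) :
  nrm (a *: x) = nrm (a : R[i]^o) * nrm x.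
Proof. by apply: (@complexI R); rewrite rmorphM/= -!nrmE normrZ. Qed.

Lemma nrmM (a b : R[i]^o) : nrm (a * b : R[i]^o) = nrm a * nrm b.
Proof. exact: (nrmZ (V := R[i]^o)). Qed.

Lemma nrm_real (r : R) : 0 <= r -> nrm (r%:C%C : R[i]^o) = r.
Proof. by move=> r0; apply: (@complexI R); rewrite -nrmE ger0_norm// ler0c. Qed.

Lemma nrm_sum (V : normedZmodType R[i]) (I : Type) (s : seq I) (P : pred I)
    (F : I -> V) : nrm (\sum_(i <- s | P i) F i) <= \sum_(i <- s | P i) nrm (F i).
Proof.
elim/big_rec2 : _ => [|i y x _ h]; first by rewrite nrm0.
by rewrite (le_trans (nrmD _ _))// lerD2l.
Qed.

(** Radii of balls over [R[i]] are positive elements of [R[i]]; this turns them into real radii in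
    epsilon arguments. *)
Lemma gt0_complex_real (z : R[i]) : 0 < z -> exists2 r, 0 < r & z = r%:C%C.
Proof.
move=> z0; exists (complex.Re z); last by rewrite RRe_real// realE ltW.
by rewrite -ltcR RRe_real// realE ltW.
Qed.

Lemma cvg_nrmP (V : normedModType R[i]) (u : nat -> V) (l : V) :
  (u k @[k --> \oo] --> l) <-> (nrm (l - u k) @[k --> \oo] --> 0).
Proof.
split=> [/cvgrPdist_lt ul|ul].
  apply/cvgrPdist_lt => r r0; have := ul r%:C%C; rewrite ltcR => /(_ r0).
  apply: filterS => k; rewrite nrmE ltcR sub0r normrN ger0_norm//.
  exact: nrm_ge0.
apply/cvgrPdist_lt => _ /gt0_complex_real[r r0 ->].
move/cvgrPdist_lt : ul => /(_ _ r0).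
by apply: filterS => k; rewrite nrmE ltcR sub0r normrN ger0_norm ?nrm_ge0.
Qed.

Lemma cvg_nrm (V : normedModType R[i]) (u : nat -> V) (l : V) :
  u k @[k --> \oo] --> l -> nrm (u k) @[k --> \oo] --> nrm l.
Proof.
move/cvg_nrmP/cvgrPdist_lt => ul; apply/cvgrPdist_lt => r /ul.
apply: filterS => k; rewrite sub0r normrN ger0_norm ?nrm_ge0//.
exact/le_lt_trans/ler_nrm_dist.
Qed.

(** The increments of [s] become small, so [u] is Cauchy. Intended for orthogonal series, with [s]
    the partial sums of the squared norms. *)
Lemma cvg_of_sqr_increments (V : completeNormedModType R[i]) (u : nat -> V)
    (s : nat -> R) :
  {homo s : k l / (k <= l)%N >-> k <= l} -> cvgn s ->
  (forall k l, (k <= l)%N -> nrm (u l - u k) ^+ 2 <= s l - s k) -> cvgn u.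
Proof.
move=> s_nd s_cvg us; apply/cauchy_cvgP/cauchy_exP.
move=> _ /gt0_complex_real[r r0 ->].
have r20 : 0 < r ^+ 2 by rewrite exprn_gt0.
have /cvgrPdist_lt/(_ _ r20)[N _ sN] := s_cvg.
exists (u N); exists N => // k /= Nk.
rewrite -ball_normE/= nrmE ltcR nrmC.
rewrite -(ltr_pXn2r (n := 2)) ?nnegrE ?nrm_ge0 ?(ltW r0)//.
apply: le_lt_trans (us _ _ Nk) _; apply: le_lt_trans (sN N (leqnn N)).
rewrite (le_trans _ (ler_norm _))// lerD2r.
exact: nondecreasing_cvgn_le.
Qed.

End real_valued_norm.

(** * Partially defined operators and closable functionals *)

Section linear_operators.
Context {R : realType} {U V : normedModType R[i]} (T : linop U V).

Lemma linop0 : T 0 = 0.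
Proof.
have := app_lin 1 (dom_zero T) (dom_zero T).
by rewrite !scale1r addr0 -[X in X = _]addr0 => /addrI <-.
Qed.

Lemma dom_linZ (a : R[i]) x : dom T x -> dom T (a *: x).
Proof. by move=> Tx; rewrite -[_ *: _]addr0; apply: dom_lin (dom_zero T). Qed.

Lemma linopZ (a : R[i]) x : dom T x -> T (a *: x) = a *: T x.
Proof.
move=> Tx; rewrite -[a *: x]addr0 app_lin//; last exact: dom_zero.
by rewrite linop0 addr0.
Qed.

Lemma dom_linB x y : dom T x -> dom T y -> dom T (x - y).
Proof. by move=> Tx Ty; rewrite addrC -scaleN1r; apply: dom_lin. Qed.

Lemma linopB x y : dom T x -> dom T y -> T (x - y) = T x - T y.
Proof. by move=> Tx Ty; rewrite addrC -scaleN1r app_lin// scaleN1r addrC. Qed.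

Lemma linop_sum (I : Type) (s : seq I) (P : pred I) (c : I -> R[i]) (v : I -> U) :
  (forall i, dom T (v i)) ->
  dom T (\sum_(i <- s | P i) c i *: v i) /\
  T (\sum_(i <- s | P i) c i *: v i) = \sum_(i <- s | P i) c i *: T (v i).
Proof.
move=> Tv; apply: (big_ind2 (fun x y => dom T x /\ T x = y)) =>
    [|x x' y y' [Tx Ex] [Ty Ey]|i _].
- by split; [exact: dom_zero|exact: linop0].
- split; first by rewrite -[x]scale1r; apply: dom_lin.
  by rewrite -[x]scale1r app_lin// scale1r Ex Ey.
- by split; [exact: dom_linZ|exact: linopZ].
Qed.

End linear_operators.

(* An unbounded functional takes the value 1 on arbitrarily small vectors, which
   puts (0, 1) in the closure of its graph. *)
Lemma closable_functional_bounded (R : realType) (U : normedModType R[i])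
    (T : linop U R[i]^o) :
  closable T -> exists K : R, forall x, dom T x -> nrm (T x) <= K * nrm x.
Proof.
move=> [S grS].
have nS : ~ closure (graph T) (0, 1).
  rewrite grS => -[_ /= /eqP]; rewrite linop0 => /eqP/esym/eqP.
  by rewrite eq_sym oner_eq0.
have [d d0 small] : exists2 d : R, 0 < d &
    forall x, dom T x -> nrm x < d -> T x <> 1.
  apply: contrapT => h; apply: nS => W /nbhs_ballP[_ /gt0_complex_real[d d0 ->]] dW.
  apply: contrapT => nW; apply: h; exists d => // x Tx xd T1; apply: nW.
  exists (x, T x); split=> //; apply: dW; split=> /=.
    by rewrite -ball_normE/= sub0r normrN nrmE ltcR.
  by rewrite T1; apply: ballxx; rewrite ltcR.
(* If [nrm (T x) >= 1], dividing [x] by [T x] does not increase its norm and yields the excluded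
   value 1. *)
have lt1 x : dom T x -> nrm x < d -> nrm (T x) < 1.
  move=> Tx xd; rewrite ltNge; apply/negP => Tx1.
  have Tx0 : T x != 0 by rewrite -nrm_eq0 gt_eqF// (lt_le_trans ltr01).
  apply: (small ((T x)^-1 *: x)); first exact: dom_linZ.
    rewrite nrmZ (le_lt_trans _ xd)// ler_piMl ?nrm_ge0//.
    rewrite -(ler_pM2l (lt_le_trans ltr01 Tx1)) mulr1 -nrmM divff//.
    by rewrite nrm_real ?ler01.
  by rewrite linopZ//; exact: mulVf.
(* The constant comes from rescaling a nonzero [x] to norm [d / 2]. *)
exists (2 / d) => x Tx.
have [->|x0] := eqVneq x 0; first by rewrite linop0 !nrm0 mulr0.
have nx0 : 0 < nrm x by rewrite lt_neqAle nrm_ge0 eq_sym nrm_eq0 x0.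
have t0 : 0 < d / (2 * nrm x) by rewrite divr_gt0// mulr_gt0.
have := lt1 _ (dom_linZ (d / (2 * nrm x))%:C%C Tx).
rewrite linopZ// !nrmZ nrm_real; last exact: ltW.
have -> : d / (2 * nrm x) * nrm x = d / 2 by field; rewrite gt_eqF.
have d2 : d / 2 < d by rewrite ltr_pdivrMr// mulr2n mulrDr mulr1 ltrDl.
move=> /(_ d2); rewrite mulrC -ltr_pdivlMr// div1r invf_div => /ltW.
by rewrite mulrAC.
Qed.

(** * Sums along an exhaustion *)

Section exhausting_sums.
Context {M : choiceType} (Mk : nat -> {fset M}).
Hypothesis Mk_exh : exhaustion Mk.

Lemma exhaustion_mono k l : (k <= l)%N -> {subset Mk k <= Mk l}.
Proof.
move=> kl; apply/fsubsetP; elim: l kl => [|l IH]; first by rewrite leqn0 => /eqP ->.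
rewrite leq_eqVlt => /predU1P[->//|/IH kl]; exact: fsubset_trans (Mk_exh.1 l).
Qed.

Lemma exhaustion_seq (s : seq M) :
  exists N, forall k, (N <= k)%N -> {subset s <= Mk k}.
Proof.
elim: s => [|n s [N hN]]; first by exists 0%N.
have [N' hN'] := Mk_exh.2 n; exists (maxn N N') => k.
rewrite geq_max => /andP[Nk N'k] i; rewrite inE => /predU1P[->|/hN]; last exact.
exact: exhaustion_mono hN'.
Qed.

(** Isolates the increment between two partial sums, as needed for monotonicity and for Cauchy
    estimates. *)
Lemma sum_exhaustion_split (V : zmodType) (P : pred M) (F : M -> V) k l :
  (k <= l)%N ->
  \sum_(n <- Mk l | P n) F n = \sum_(n <- Mk k | P n) F n +
    \sum_(n <- Mk l | P n && (n \notin Mk k)) F n.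
Proof.
move=> kl; rewrite (bigID (mem (Mk k)))/=; congr +%R.
under eq_bigl do rewrite andbC; rewrite -big_filter_cond; apply: perm_big.
apply: uniq_perm; rewrite ?filter_uniq ?fset_uniq// => n.
by rewrite mem_filter; case: (boolP (n \in Mk k)) => //= /(exhaustion_mono kl) ->.
Qed.

Section nonnegative_real.
Context {R : realType} (P : pred M) (a : M -> R).
Hypothesis a_ge0 : forall n, 0 <= a n.

Lemma sum_exhaustion_nondecreasing :
  {homo (fun k => \sum_(n <- Mk k | P n) a n) : k l / (k <= l)%N >-> k <= l}.
Proof.
by move=> k l kl /=; rewrite (sum_exhaustion_split _ _ kl) lerDl sumr_ge0.
Qed.

(** Partial sums of nonnegative terms increase, so the limit is a supremum and can be bounded
    through finite sums. *)
Lemma limn_sum_exhaustion :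
  limn (fun k => \sum_(n <- Mk k | P n) (a n)%:E)%E =
  ereal_sup (range (fun k => (\sum_(n <- Mk k | P n) a n)%:E)).
Proof.
under [in LHS]eq_fun do rewrite sumEFin.
apply/cvg_lim => //; apply: ereal_nondecreasing_cvgn => k l kl.
by rewrite lee_fin; exact: sum_exhaustion_nondecreasing.
Qed.

Lemma cvgn_sum_exhaustion :
  (limn (fun k => \sum_(n <- Mk k | P n) (a n)%:E)%E < +oo)%E ->
  cvgn (fun k => \sum_(n <- Mk k | P n) a n).
Proof.
rewrite limn_sum_exhaustion => lt_oo.
apply: nondecreasing_is_cvgn sum_exhaustion_nondecreasing _.
exists (fine (ereal_sup (range (fun k => (\sum_(n <- Mk k | P n) a n)%:E)))).
move=> _ [k _ <-]; have le_sup : ((\sum_(n <- Mk k | P n) a n)%:E <=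
    ereal_sup (range (fun k => (\sum_(n <- Mk k | P n) a n)%:E)))%E.
  by apply: ereal_sup_ubound; exists k.
rewrite -lee_fin fineK// fin_numElt lt_oo andbT.
exact: lt_le_trans (ltNyr _) le_sup.
Qed.

End nonnegative_real.
End exhausting_sums.

(** * Orthogonality and Fourier expansions *)

Section hilbert.
Context {R : realType} {H : normedModType R[i]}.
Variable dot : {dot H for @Num.conj R[i]}.
Hypothesis dot_norm : induces_norm dot.

Lemma dot_nrm x : dot x x = ((nrm x) ^+ 2)%:C%C.
Proof. by rewrite dot_norm nrmE rmorphXn. Qed.

Lemma pythagoras x y : dot x y = 0 ->
  nrm (x + y) ^+ 2 = nrm x ^+ 2 + nrm y ^+ 2.
Proof.
move=> xy; apply: (@complexI R); rewrite rmorphD/= -!dot_nrm dnormD xy.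
by rewrite conjC0 !addr0.
Qed.

Lemma pythagoras_sum (M : eqType) (v : M -> H) (s : seq M) (P : pred M)
    (c : M -> R[i]) :
  (forall n n', n <> n' -> dot (v n) (v n') = 0) -> uniq s ->
  nrm (\sum_(n <- s | P n) c n *: v n) ^+ 2 =
  \sum_(n <- s | P n) nrm (c n : R[i]^o) ^+ 2 * nrm (v n) ^+ 2.
Proof.
move=> orth; elim: s => [|n s IH /= /andP[ns us]].
  by rewrite !big_nil nrm0 expr2 mulr0.
rewrite !big_cons; case: ifP => Pn; last exact: IH.
rewrite pythagoras ?IH ?nrmZ ?exprMn//.
rewrite linear_sumr big_seq_cond big1// => i /andP[is_ _].
rewrite linearZr_LR linearZl_LR/= orth ?mulr0//.
by move=> ni; rewrite ni is_ in ns.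
Qed.

Context {M : choiceType} (Mk : nat -> {fset M}) (e : M -> H).
Hypotheses (Mk_exh : exhaustion Mk) (e_basis : orthonormal_basis dot e).

(** The partial sum is the orthogonal projection of [x] onto the span of the [e n] with [n] in
    [Mk k]. Once [Mk k] contains the indices of a good approximant [y] from the dense span, it is at
    least as close to [x] as [y]. *)
Lemma fourier_cvg x :
  \sum_(n <- Mk k) dot x (e n) *: e n @[k --> \oo] --> x.
Proof.
have [e_orth e_dense] := e_basis.
apply/cvg_nrmP/cvgrPdist_lt => r r0.
have [|y [xy [s [c yE]]]] := e_dense (ball x r%:C%C)^° _ (@open_interior _ _).
  by exists x; apply: nbhsx_ballx; rewrite ltcR.
have {}xy : nrm (x - y) < r.
  by move/interior_subset : xy; rewrite -ball_normE/= nrmE ltcR.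
have [N sN] := exhaustion_seq Mk_exh s; exists N => // k /= Nk.
rewrite sub0r normrN ger0_norm ?nrm_ge0//.
apply: le_lt_trans xy; set z := \sum_(n <- _) _.
have z_orth n : n \in Mk k -> dot (x - z) (e n) = 0.
  move=> nk; rewrite linearBl/= linear_sumlz (bigD1_seq n) ?fset_uniq//=.
  rewrite linearZl_LR/= e_orth eqxx mulr1 big1 ?addr0 ?subrr// => i /negbTE ni.
  by rewrite linearZl_LR/= e_orth ni mulr0.
rewrite -(ler_pXn2r (n := 2)) ?nnegrE ?nrm_ge0//.
(* Both [z] and [y] are combinations of basis vectors indexed in [Mk k], to which [x - z] is
   orthogonal. *)
have zy : dot (x - z) (z - y) = 0.
  rewrite linearBr/= {2}/z yE !linear_sumr !big_seq !big1 ?subr0// => i.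
    by move/(sN _ Nk) => ik; rewrite linearZr_LR/= z_orth ?mulr0.
  by move=> ik; rewrite linearZr_LR/= z_orth ?mulr0.
by rewrite -[x - y](subrKA z) (pythagoras zy) lerDl sqr_ge0.
Qed.

End hilbert.

(** By Pythagoras the squared increments of the images are those of a convergent real series, so the
    images converge. Closedness puts [x] with their limit in the graph; in particular [x] lies in
    the domain. *)
Lemma linop_fourier_cvg (R : realType) (H : normedModType R[i])
    (H' : completeNormedModType R[i]) (dot : {dot H for @Num.conj R[i]})
    (dot' : {dot H' for @Num.conj R[i]}) (M : choiceType) (Mk : nat -> {fset M})
    (e : M -> H) (T : linop H H') (x : H) :
  induces_norm dot -> induces_norm dot' -> exhaustion Mk ->
  orthonormal_basis dot e -> closed_op T -> (forall n, dom T (e n)) ->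
  (forall n n', n <> n' -> dot' (T (e n)) (T (e n')) = 0) ->
  (sumM Mk (fun n => nrm (dot x (e n) : R[i]^o) ^+ 2 * nrm (T (e n)) ^+ 2)%R
    < +oo)%E ->
  T (\sum_(n <- Mk k) dot x (e n) *: e n) @[k --> \oo] --> T x.
Proof.
move=> dotH dotH' Mk_exh e_basis T_closed Te T_orth.
set a := fun n => _; move=> a_fin.
have a0 n : 0 <= a n by rewrite mulr_ge0 ?sqr_ge0.
have s_cvg := cvgn_sum_exhaustion Mk_exh (P := predT) a0 a_fin.
have s_nd := sum_exhaustion_nondecreasing Mk_exh predT a0.
set u := fun k => T _.
have uE k : u k = \sum_(n <- Mk k) dot x (e n) *: T (e n).
  by rewrite /u; have [_ ->] := linop_sum (Mk k) predT (fun n => dot x (e n)) Te.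
have u_cvg : cvgn u.
  apply: cvg_of_sqr_increments s_nd s_cvg _ => k l kl.
  rewrite !uE 2!(sum_exhaustion_split Mk_exh predT _ kl).
  rewrite !(addrC (\sum_(n <- Mk k) _)) !addrK.
  by rewrite (pythagoras_sum dotH')// fset_uniq.
have : graph T (x, lim (u k @[k --> \oo])).
  apply: (@closed_cvg _ _ \oo _
      (fun k => (\sum_(n <- Mk k) dot x (e n) *: e n, u k)) _ T_closed).
    near=> k; split=> //=.
    by have [] := linop_sum (Mk k) predT (fun n => dot x (e n)) Te.
  by apply: cvg_pair u_cvg; exact: fourier_cvg.
by move=> [_ /= <-].
Unshelve. all: by end_near.
Qed.

(** Boundedness on the domain controls the error at [x] by a multiple of the distance from [x] to
    its partial Fourier sum. *)
Lemma functional_fourier_cvg (R : realType) (H : normedModType R[i])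
    (dot : {dot H for @Num.conj R[i]}) (M : choiceType) (Mk : nat -> {fset M})
    (e : M -> H) (T : linop H R[i]^o) (x : H) :
  induces_norm dot -> exhaustion Mk -> orthonormal_basis dot e ->
  closable T -> (forall n, dom T (e n)) -> dom T x ->
  T (\sum_(n <- Mk k) dot x (e n) *: e n) @[k --> \oo] --> T x.
Proof.
move=> dotH Mk_exh e_basis /closable_functional_bounded[K TK] Te Tx.
have /cvg_nrmP S_cvg := fourier_cvg dotH Mk_exh e_basis (x := x).
apply/cvg_nrmP.
have : K * nrm (x - \sum_(n <- Mk k) dot x (e n) *: e n) @[k --> \oo] --> 0.
  by rewrite -[X in _ --> X](mulr0 K); exact: cvgMr.
apply: squeeze_cvgr (cvg_cst 0); apply: nearW => k.
have [dS _] := linop_sum (Mk k) predT (fun n => dot x (e n)) Te.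
by rewrite nrm_ge0 -linopB// TK//; exact: dom_linB.
Qed.

(** * Finite combinations of basis vectors *)

Section finite_combinations.
Context {R : realType} {H H' : normedModType R[i]}.
Context {dot : {dot H for @Num.conj R[i]}} {dot' : {dot H' for @Num.conj R[i]}}.
Context {M : choiceType} {Mk : nat -> {fset M}} {e : M -> H}.
Context {m : nat} {B : 'I_m.+1 -> linop H H'}.
Hypothesis dotH' : induces_norm dot'.
Hypotheses (Mk_exh : exhaustion Mk) (e_basis : orthonormal_basis dot e).
Hypothesis Be : forall n j, dom (B j) (e n).
Hypothesis B_orth : forall j n n', n <> n' ->
  dot' (B j (e n)) (B j (e n')) = 0.

Lemma bh_ge0 (h : 'I_m.+1 -> R) n : (forall j, 0 < h j) -> 0 <= bh e B h n.
Proof. by move=> h0; apply: sumr_ge0 => j _; rewrite mulr_ge0 ?sqr_ge0 ?ltW. Qed.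

(** Pythagoras for each [B j], then an exchange of sums, gives a single weighted sum over [n]. The
    predicate [P] allows indices of zero weight to be dropped. *)
Lemma sum_sqr_nrm_comb (h : 'I_m.+1 -> R) (P : pred M) (c : M -> R[i]) k :
  \sum_j h j * nrm (B j (\sum_(n <- Mk k | P n) c n *: e n)) ^+ 2 =
  \sum_(n <- Mk k | P n) nrm (c n : R[i]^o) ^+ 2 * bh e B h n.
Proof.
transitivity (\sum_j \sum_(n <- Mk k | P n)
    nrm (c n : R[i]^o) ^+ 2 * (h j * nrm (B j (e n)) ^+ 2)); last first.
  by rewrite exchange_big/=; apply: eq_bigr => n _; rewrite mulr_sumr.
apply: eq_bigr => j _; have [_ ->] := linop_sum (Mk k) P c (fun n => Be n j).
rewrite (pythagoras_sum dotH') ?fset_uniq//; last exact: B_orth.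
by rewrite mulr_sumr; apply: eq_bigr => n _; rewrite mulrCA.
Qed.

(** Makes test vectors admissible: the coefficients vanish off [Mk k], so every partial sum is at
    most the one over [Mk k]. *)
Lemma HB_space_comb (P : pred M) (c : M -> R[i]) k :
  HB_space dot Mk e B (\sum_(n <- Mk k | P n) c n *: e n).
Proof.
move=> j; set x := \sum_(n <- _ | _) _; set a := fun n => _.
have a0 n : 0 <= a n by rewrite mulr_ge0 ?sqr_ge0.
have aNk n : n \notin Mk k -> a n = 0.
  move=> nk; rewrite /a /x linear_sumlz big_seq_cond big1 ?nrm0 ?expr0n ?mul0r//.
  move=> i /andP[ik _]; rewrite linearZl_LR/= e_basis.1.
  by case: eqP nk ik => [-> /negP//|]; rewrite mulr0.
rewrite /sumM (limn_sum_exhaustion Mk_exh predT a0).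
apply: (@le_lt_trans _ _ (\sum_(n <- Mk k) a n)%:E); last exact: ltry.
apply: ge_ereal_sup => _ [l _ <-]; rewrite lee_fin.
apply: le_trans (sum_exhaustion_nondecreasing Mk_exh predT a0 (leq_maxr k l)) _.
rewrite (sum_exhaustion_split Mk_exh predT _ (leq_maxl k l)).
by rewrite [X in _ + X]big1 ?addr0// => n /aNk.
Qed.

End finite_combinations.

(** * The supremum in terms of finite sums *)

Section supC_bounds.
Context {R : realType} {H H' X : normedModType R[i]}.
Context {M : choiceType} {Mk : nat -> {fset M}} {e : M -> H}.
Context {m : nat} {B : 'I_m.+1 -> linop H H'}.
Context {A : linop H X} {f : {linear X -> R[i]^o}} {lam : 'I_m.+1 -> R}.
Hypothesis Mk_exh : exhaustion Mk.
Hypothesis supC_fin : (supC Mk e B A f lam < +oo)%E.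

Let a n := nrm (f (A (e n))) ^+ 2.
Let C := fine (supC Mk e B A f lam).

Let ratio_ge0 h n : (forall j, 0 < h j) -> 0 <= a n / bh e B h n.
Proof. by move=> h0; rewrite divr_ge0 ?sqr_ge0 ?bh_ge0. Qed.

Let prod_gt0 h : (forall j, 0 < h j) -> 0 < \prod_j h j `^ lam j.
Proof. by move=> h0; apply: prodr_gt0 => j _; rewrite powR_gt0. Qed.

Let tilde_le h : (forall j, 0 < h j) ->
  ((\prod_j h j `^ lam j)%:E * tilde_sum Mk a (bh e B h)
    <= supC Mk e B A f lam)%E.
Proof. by move=> h0; apply: ereal_sup_ubound; exists h. Qed.

(** Otherwise the extended sum for this [h] is infinite and, multiplied by a positive product, makes
    the supremum infinite. *)
Lemma bh_eq0 h n : (forall j, 0 < h j) -> bh e B h n = 0 -> f (A (e n)) = 0.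
Proof.
move=> h0 bn; apply: contrapT => fn; have := tilde_le h0.
rewrite /tilde_sum asboolT; last first.
  exists n; split=> //; apply/eqP; rewrite expf_eq0/= nrm_eq0; exact/eqP.
rewrite gt0_muley ?lte_fin ?prod_gt0// leye_eq => /eqP C_oo.
by have := supC_fin; rewrite C_oo.
Qed.

Let tilde_sumE h : (forall j, 0 < h j) -> tilde_sum Mk a (bh e B h) =
  ereal_sup (range (fun k =>
    (\sum_(n <- Mk k | bh e B h n != 0) a n / bh e B h n)%:E)).
Proof.
move=> h0; rewrite /tilde_sum asboolF; last first.
  by move=> [n [an /(bh_eq0 h0) fn]]; apply: an; rewrite /a fn nrm0 expr0n.
by rewrite limn_sum_exhaustion// => n; exact: ratio_ge0.
Qed.

Let supC_ge0 : (0 <= supC Mk e B A f lam)%E.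
Proof.
apply: (le_trans _ (tilde_le (h := fun=> 1) (fun=> ltr01))).
rewrite mule_ge0 ?lee_fin ?(ltW (prod_gt0 _))// tilde_sumE//.
apply: (@le_trans _ _ (\sum_(n <- Mk 0 | bh e B (fun=> 1) n != 0)
    a n / bh e B (fun=> 1) n)%:E); last by apply: ereal_sup_ubound; exists 0%N.
by rewrite lee_fin sumr_ge0// => n _; exact: ratio_ge0.
Qed.

Let supCE : supC Mk e B A f lam = C%:E.
Proof. by rewrite fineK// ge0_fin_numE. Qed.

Lemma fine_supC_ge0 : 0 <= C.
Proof. exact: fine_ge0. Qed.

(** With [fine_supC_le], this makes [C] the least upper bound of real expressions over finite sums,
    so neither half of the theorem has to handle infinite values. *)
Lemma fine_supC_ub h k : (forall j, 0 < h j) ->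
  \prod_j h j `^ lam j * \sum_(n <- Mk k | bh e B h n != 0) a n / bh e B h n <= C.
Proof.
move=> h0; rewrite -lee_fin -supCE; apply: (le_trans _ (tilde_le h0)).
rewrite EFinM lee_pmul2l ?lte_fin ?prod_gt0// tilde_sumE//.
by apply: ereal_sup_ubound; exists k.
Qed.

Lemma fine_supC_le (K : R) :
  (forall h k, (forall j, 0 < h j) ->
    \prod_j h j `^ lam j * \sum_(n <- Mk k | bh e B h n != 0) a n / bh e B h n
      <= K) -> C <= K.
Proof.
move=> hK; rewrite -lee_fin -supCE; apply: ge_ereal_sup => _ [h h0 <-].
rewrite -/a tilde_sumE// -lee_pdivlMl ?prod_gt0//.
apply: ge_ereal_sup => _ [k _ <-].
by rewrite -EFinM lee_fin ler_pdivlMl ?prod_gt0// hK.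
Qed.

End supC_bounds.

(** * The inequality and its sharpness *)

Theorem theorem7 (R : realType)
    (H H' : completeNormedModType R[i]) (X : normedModType R[i])
    (dot : {dot H for @Num.conj R[i]}) (dot' : {dot H' for @Num.conj R[i]})
    (M : countType) (Mk : nat -> {fset M}) (e : M -> H)
    (m : nat) (B : 'I_m.+1 -> linop H H')
    (A : linop H X) (f : {linear X -> R[i]^o}) (lam : 'I_m.+1 -> R) :
  induces_norm dot -> induces_norm dot' ->
  exhaustion Mk -> orthonormal_basis dot e ->
  (forall j, closed_op (B j)) ->
  (forall n j, dom (B j) (e n)) ->
  (forall j n' n'', n' <> n'' -> dot' (B j (e n')) (B j (e n'')) = 0) ->
  (exists j0 n0, B j0 (e n0) <> 0) ->
  bounded_near f (nbhs (0 : X)) ->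
  (forall n, dom A (e n)) ->
  (exists n0, f (A (e n0)) <> 0) ->
  closable (linop_comp f A) ->
  (forall j, 0 < lam j) ->
  \sum_(j < m.+1) lam j = 1 ->
  (supC Mk e B A f lam < +oo)%E ->
  let c := Num.sqrt (fine (supC Mk e B A f lam)
                     * \prod_(j < m.+1) lam j `^ (- lam j)) in
  (forall x, dom A x -> HB_space dot Mk e B x ->
     nrm (f (A x)) <= c * \prod_(j < m.+1) nrm (B j x) `^ lam j) /\
  (forall c' : R,
     (forall x, dom A x -> HB_space dot Mk e B x ->
        nrm (f (A x)) <= c' * \prod_(j < m.+1) nrm (B j x) `^ lam j) ->
     c <= c').
Proof.
move=> dotH dotH' Mk_exh e_basis B_closed Be B_orth _ _ Ae [n0 fAn0] gf_clos
  lam0 sum_lam supC_fin c.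
have C0 := fine_supC_ge0 Mk_exh supC_fin.
rewrite {}/c; set C := fine _ in C0 *.
pose L := \prod_j lam j `^ (- lam j).
have L0 : 0 < L by apply: prodr_gt0 => j _; rewrite powR_gt0.
have prod_sqr (t : 'I_m.+1 -> R) : (forall j, 0 <= t j) ->
    \prod_j (t j ^+ 2) `^ lam j = (\prod_j t j `^ lam j) ^+ 2.
  move=> t0; rewrite expr2 -big_split/=; apply: eq_bigr => j _.
  by rewrite expr2 powRM.
split=> [x Ax HBx|c' c'P].
- have prod0 : 0 <= \prod_j nrm (B j x) `^ lam j.
    by apply: prodr_ge0 => j _; exact: powR_ge0.
  rewrite -(ler_pXn2r (n := 2)) ?nnegrE ?nrm_ge0 ?mulr_ge0 ?sqrtr_ge0//.
  rewrite exprMn sqr_sqrtr ?mulr_ge0 ?(ltW L0)// -prod_sqr; last first.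
    by move=> j; exact: nrm_ge0.
  (* After squaring, the optimisation over [h] leaves one quadratic bound for each fixed [h], proved
     for partial Fourier sums and passed to the limit. *)
  apply: le_prod_powR => // [j|h h0]; first exact: sqr_ge0.
  pose u k := \sum_(n <- Mk k) dot x (e n) *: e n.
  have fu : nrm (f (A (u k))) @[k --> \oo] --> nrm (f (A x)).
    apply: (@cvg_nrm _ _ (fun k => linop_comp f A (u k)) (linop_comp f A x)).
    exact: functional_fourier_cvg.
  have Bu j : nrm (B j (u k)) @[k --> \oo] --> nrm (B j x).
    apply: cvg_nrm; by apply: linop_fourier_cvg => //; exact: B_orth.
  have cl : \prod_j h j `^ lam j * nrm (f (A (u k))) ^+ 2 @[k --> \oo] -->
      \prod_j h j `^ lam j * nrm (f (A x)) ^+ 2.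
    by apply: cvgMr; rewrite !expr2; apply: cvgM.
  have cr : C * \sum_j h j * nrm (B j (u k)) ^+ 2 @[k --> \oo] -->
      C * \sum_j h j * nrm (B j x) ^+ 2.
    apply: cvgMr; apply: cvg_big => [|j _]; first exact: add_continuous.
    by apply: cvgMr; rewrite !expr2; apply: cvgM.
  apply: ler_cvg_to cl cr _; apply: nearW => k.
  have P0 : 0 < \prod_j h j `^ lam j.
    by apply: prodr_gt0 => j _; rewrite powR_gt0.
  rewrite /u (sum_sqr_nrm_comb dotH' Be B_orth h predT).
  set Q := (X in _ <= C * X).
  have Q0 : 0 <= Q.
    by apply: sumr_ge0 => n _; rewrite mulr_ge0 ?sqr_ge0 ?bh_ge0.
  apply: le_trans (ler_wpM2r Q0 (fine_supC_ub Mk_exh supC_fin k h0)).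
  rewrite -mulrA ler_pM2l//.
  have [_ fAuE] := linop_sum (T := linop_comp f A) (Mk k) predT
    (fun n => dot x (e n)) Ae.
  rewrite -[f (A _)]/(linop_comp f A _) fAuE [X in _ <= X * _]big_mkcond/=.
  apply: (@le_trans _ _ ((\sum_(n <- Mk k)
      nrm (dot x (e n) *: f (A (e n)) : R[i]^o)) ^+ 2)).
    rewrite ler_pXn2r ?nnegrE ?nrm_ge0//; first exact: nrm_sum.
    by apply: sumr_ge0 => n _; exact: nrm_ge0.
  (* The weights are |f(A e_n)|^2 / b_n, set to 0 when b_n = 0, and |x_n|^2 b_n. If b_n = 0,
     finiteness of the supremum forces f(A e_n) = 0, so the termwise bound survives. *)
  apply: sqr_sum_le_mul_sum => n _; first exact: nrm_ge0.
  + by case: ifP => // _; rewrite divr_ge0 ?sqr_ge0 ?bh_ge0.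
  + by rewrite mulr_ge0 ?sqr_ge0 ?bh_ge0.
  + rewrite nrmZ exprMn; case: eqVneq => [/(bh_eq0 supC_fin h0) ->|bn].
      by rewrite nrm0 expr0n mulr0 mul0r.
    by rewrite [leRHS]mulrCA divfK.
(* Needed for squaring: a negative [c'], tested on [e n0], would force [f (A (e n0)) = 0]. *)
- have c'0 : 0 <= c'.
    rewrite leNgt; apply/negP => c'0; apply: fAn0; apply/eqP.
    rewrite -nrm_eq0 eq_le nrm_ge0 andbT.
    have HBe : HB_space dot Mk e B (e n0).
      have [k n0k] := Mk_exh.2 n0.
      have := HB_space_comb Mk_exh (B := B) e_basis (pred1 n0) (fun=> 1) k.
      by rewrite -big_filter filter_pred1_uniq ?fset_uniq// big_seq1 scale1r.
    apply: le_trans (c'P _ (Ae n0) HBe) _.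
    rewrite mulr_le0_ge0 ?(ltW c'0)//.
    by apply: prodr_ge0 => j _; exact: powR_ge0.
  rewrite -(ler_pXn2r (n := 2)) ?nnegrE ?sqrtr_ge0// sqr_sqrtr; last first.
    by rewrite mulr_ge0// (ltW L0).
  rewrite -/L -ler_pdivlMr//.
  apply: (fine_supC_le Mk_exh supC_fin) => h k h0.
  set T := \sum_(n <- _ | _) _.
  have T0 : 0 <= T.
    by apply: sumr_ge0 => n _; rewrite divr_ge0 ?sqr_ge0 ?bh_ge0.
  (* Positivity of [T] is used at the end to cancel a factor [T]. *)
  have [->|Tn0] := eqVneq T 0; first by rewrite mulr0 divr_ge0 ?sqr_ge0 ?ltW.
  have Tgt0 : 0 < T by rewrite lt_neqAle eq_sym Tn0.
  (* extremal vector for the Cauchy-Schwarz step of the upper bound *)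
  pose w n := (f (A (e n)))^* * ((bh e B h n)^-1)%:C%C.
  pose x := \sum_(n <- Mk k | bh e B h n != 0) w n *: e n.
  have [Ax fAx] := linop_sum (T := linop_comp f A) (Mk k)
    (fun n => bh e B h n != 0) w Ae.
  (* Equality case: the products w_n f(A e_n) and |w_n|^2 b_n both equal |f(A e_n)|^2 / b_n, so the
     functional and the quadratic form both give [T] at [x]. *)
  have nfAx : nrm (f (A x)) = T.
    rewrite -[f (A x)]/(linop_comp f A x) fAx -[RHS]nrm_real// /T rmorph_sum/=.
    congr nrm; apply: eq_bigr => n _.
    rewrite rmorphM/= rmorphXn/= -nrmE normCK -[LHS]/(_ * _) /w.
    by rewrite mulrAC [in LHS](mulrC _^*).
  have sumBx : \sum_j h j * nrm (B j x) ^+ 2 = T.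
    rewrite (sum_sqr_nrm_comb dotH' Be B_orth); apply: eq_bigr => n bn.
    have bn0 : 0 <= (bh e B h n)^-1 by rewrite invr_ge0 bh_ge0.
    rewrite [nrm _](nrmM (f (A (e n)))^* ((bh e B h n)^-1)%:C%C) nrm_real//.
    rewrite exprMn -mulrA expr2 -[_ * _ * bh _ _ _ _]mulrA mulVf// mulr1.
    by congr (_ ^+ 2 * _); apply: (@complexI R); rewrite -!nrmE norm_conjC.
  have := c'P x Ax (HB_space_comb Mk_exh e_basis _ _ _); rewrite nfAx => le_T.
  have := prod_powR_le_sum lam0 sum_lam h0 (fun j => sqr_ge0 (nrm (B j x))).
  rewrite sumBx prod_sqr => [le_P|j]; last exact: nrm_ge0.
  have LE : L^-1 = \prod_j lam j `^ lam j.
    by rewrite -prodfV; apply: eq_bigr => j _; rewrite powRN invrK.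
  (* With P the weighted product of the |B_j x|, T <= c' P and prod_j h_j^lam_j P^2 <= L^-1 T
     combine to prod_j h_j^lam_j T^2 <= c'^2 L^-1 T, which is the goal times [T]. *)
  rewrite LE -(ler_pM2r Tgt0) -mulrA -mulrA.
  apply: le_trans (ler_wpM2l (sqr_ge0 c') le_P).
  rewrite [leRHS]mulrCA ler_wpM2l ?prodr_ge0// => [j _|]; first exact: powR_ge0.
  by rewrite -exprMn -expr2 ler_pXn2r ?nnegrE// (le_trans T0).
Qed.
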